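(* Let $k$ be a positive integer. If $T$ is a finite tree with $k+1 \leq \operatorname{diam}(T) \leq 2k-4$, then $$c_{H,k}(T) \leq 2 + \left\lfloor \frac{k}{2} - \frac{\operatorname{diam}(T)}{4} \right\rfloor \leq 2 + \left\lfloor \frac{k}{2} \right\rfloor - \left\lfloor \frac{\operatorname{diam}(T)}{4} \right\rfloor.$$
   Context: The $k$-hyperopic game of cops and robber ($k \ge 1$ an integer) on a finite connected simple graph $G$ is played by a team of cops (controlled by one player) and one robber, all occupying vertices of $G$. First the cops choose their starting vertices (several cops may share a vertex), then the robber chooses his starting vertex. Then the players alternate turns, cops first: on the cops' turn each cop stays or moves to an adjacent vertex; on the robber's turn he stays or moves to an adjacent vertex. The robber always sees the positions of all cops. The robber is invisible to the cops whenever every cop satisfies $1 \le d(r,c) \le k$, where $r$ and $c$ are the current positions of the robber and that cop and $d$ is graph distance; otherwise (in particular whenever some cop is at distance greater than $k$ from him) his position is known to all cops. The robber is omniscient: he knows the complete strategy of the cops in advance, so he is never captured by chance, i.e. a winning cop strategy must guarantee capture against every possible play of the robber. The cops win if after finitely many rounds some cop occupies the same vertex as the robber; otherwise the robber wins. The $k$-hyperopic cop number $c_{H,k}(G)$ is the minimum number of cops that have a winning strategy on $G$. The diameter $\operatorname{diam}(G)$ is the maximum distance between two vertices of $G$. *)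

(* Defs.v *)
From mathcomp Require Import all_boot all_order all_algebra.
From mathcomp Require Import boolp.

Set Implicit Arguments.
Unset Strict Implicit.
Unset Printing Implicit Defensive.

Section Graph.
Variables (V : finType) (e : rel V).

Definition simple_graph : Prop := symmetric e /\ irreflexive e.

Definition connected_graph : Prop :=
  (0 < #|V|)%N /\ forall x y : V, connect e x y.

(* [ucycle e p] also holds of a single edge traversed back and forth, hence
   the bound on the length. *)
Definition acyclic_graph : Prop :=
  forall p : seq V, (2 < size p)%N -> ~ ucycle e p.

Definition tree : Prop :=
  [/\ simple_graph, connected_graph & acyclic_graph].

Definition walk_of_length (n : nat) (x y : V) : bool :=
  [exists p : n.-tuple V, path e x p && (last x p == y)].

(* The least length of a walk from x to y. Shortest walks have length less
   than #|V|, so the default value #|V| of the search is taken only when x and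
   y are not connected. *)
Definition dist (x y : V) : nat :=
  find (fun n => walk_of_length n x y) (iota 0 #|V|).

Definition diam : nat := \max_(x : V) \max_(y : V) dist x y.

End Graph.

Section Game.
Variables (V : finType) (e : rel V) (k : nat).

Definition step (x y : V) : bool := (y == x) || e x y.

Section Cops.
Variable m : nat.

Notation cops := {ffun 'I_m -> V}.

Definition invisible (c : cops) (r : V) : bool :=
  [forall i, (1 <= dist e r (c i) <= k)%N].

(* What the cops know at a given instant: their own positions, and the
   position of the robber if he is visible. *)
Definition view : Type := (cops * option V)%type.

Definition view_of (c : cops) (r : V) : view :=
  (c, if invisible c r then None else Some r).

(* A strategy maps the list of all views so far, most recent first, to the next
   positions of the cops; its value at the empty list is the initial placement.
   Since the robber knows the strategy in advance and must be caught whatever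
   he does, strategies are deterministic. *)
Definition strategy : Type := seq view -> cops.

Definition legal (s : strategy) : Prop :=
  forall (v : view) (h : seq view) (i : 'I_m), step (v.1 i) (s (v :: h) i).

Definition robber_play (r : nat -> V) : Prop :=
  forall t, step (r t) (r t.+1).

(* The views of the cops before their turn in round t.+1. The cops look both
   after their own turn and after the robber's turn, so that every round adds
   two views. *)
Fixpoint history (s : strategy) (r : nat -> V) (t : nat) : seq view :=
  if t is t'.+1 then
    let h := history s r t' in
    [:: view_of (s h) (r t'.+1), view_of (s h) (r t') & h]
  else [:: view_of (s [::]) (r 0)].

Definition cops_at (s : strategy) (r : nat -> V) (t : nat) : cops :=
  if t is t'.+1 then s (history s r t') else s [::].

(* Either the robber is on the vertex of a cop after his own turn, or a cop
   moves to the vertex of the robber on the cops' next turn. *)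
Definition captured (s : strategy) (r : nat -> V) : Prop :=
  exists (t : nat) (i : 'I_m),
    cops_at s r t i = r t \/ cops_at s r t.+1 i = r t.

Definition winning (s : strategy) : Prop :=
  forall r : nat -> V, robber_play r -> captured s r.

End Cops.

Definition cops_win (m : nat) : Prop :=
  exists s : strategy m, legal s /\ winning s.

Lemma cops_win_card : cops_win #|V|.
Proof.
exists (fun h => if h is v :: _ then v.1 else [ffun i => enum_val i]).
split=> [v h i|r _]; first by rewrite /step eqxx.
by exists 0, (enum_rank (r 0)); left; rewrite /= ffunE enum_rankK.
Qed.

Lemma ex_cops_win : exists m, `[< cops_win m >].
Proof. by exists #|V|; apply/asboolP; exact: cops_win_card. Qed.

Definition hyperopic_cop_number : nat := ex_minn ex_cops_win.

End Game.

(* Main.v *)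
Require Import Defs.
From mathcomp Require Import all_boot all_order all_algebra zify lra.
From mathcomp Require boolp.

Set Implicit Arguments.
Unset Strict Implicit.
Unset Printing Implicit Defensive.

Import Order.TTheory GRing.Theory Num.Theory.

(** Let [d] be the diameter, [j] the upper half of [d] and [n] the half of
    [k - j]; it is enough that [n + 2] cops win. One of them, the spotter, sits
    at an end [u] of a diametral path from [u] to [v] and sees every vertex at
    distance more than [k] from [u]; another one, the guard, stands at the
    vertex [z] at distance [j] from [u] on this path. Beyond [z] an unseen
    robber is at depth at most [k - j] below [z].

    A guard going back and forth along an edge [w c] blocks both [w] and [c]:
    a robber on either end meets him there within one turn. Hence the robber
    cannot leave the component where he is, while the rest of the team searches
    these components in turn. Each cop of the team thus takes care of two
    levels of the tree, and [n + 1] cops search a tree of depth [2 n + 1]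
    without any information ([clears_shadow]). If the spotter sees the robber
    during the search, the guard goes down to the child of [w] on the side of
    the robber, and the search starts again in a smaller tree; this ends with a
    capture ([wins_guarded], [wins_shadow]).

    If the search below [z] catches nobody, or if the robber is seen elsewhere,
    then he is on the side of [u], which the guard at [z] prevents him from
    leaving. As [n > 0], there is a third cop, who walks to [v] and becomes the
    spotter. The cop at [u] is now free to join the search, and the guard steps
    to the neighbour [z'] of [z] towards [u]. Since [z'] is at distance at least
    [d - j + 1] from [v], the same search succeeds there ([tree_cops_win]).

    To turn this into a strategy, the cops keep track of the set of vertices
    where the robber can be: [cops_win_wins] extracts a strategy from a win in
    the game played on these sets. A schedule that needs no information is
    analysed by following one walk of the robber that it fails to catch, and
    [wins_run] transfers the result to sets. *)

(** * Distances *)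

Section Distance.
Variables (V : finType) (e : rel V).

Lemma dist_le_path x p : path e x p -> dist e x (last x p) <= size p.
Proof.
move=> ep; rewrite /dist; set a := (X in find X).
case: (ltnP (size p) #|V|) => [lt|ge]; last first.
  by apply: leq_trans ge; rewrite -[leqRHS](size_iota 0) find_size.
rewrite leqNgt; apply/negP => lt'; have := before_find 0 lt'.
rewrite nth_iota // add0n /a => /negbT/negP; apply.
rewrite /walk_of_length; apply/existsP.
by exists (in_tuple p); rewrite ep /=.
Qed.

Lemma dist_le_card x y : dist e x y <= #|V|.
Proof. by rewrite -[leqRHS](size_iota 0) find_size. Qed.

(** A walk of minimal length repeats no vertex, since its loops could be cut
    out. *)
Lemma geodesic x y : connect e x y ->
  exists p, [/\ path e x p, last x p = y, uniq (x :: p) & size p = dist e x y].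
Proof.
case/connectP=> p0 ep0 ->; case/shortenP: ep0 => {}p0 ep0 up0 _.
have [p ep [lp]] : exists2 p, path e x p &
    last x p = last x p0 /\ size p = dist e x (last x p0).
  rewrite /dist; set a := (X in find X).
  have hasa : has a (iota 0 #|V|).
    apply/hasP; exists (size p0).
      have := max_card (mem (x :: p0)); rewrite (card_uniqP up0) => szp.
      by rewrite mem_iota add0n.
    by rewrite /a /walk_of_length; apply/existsP; exists (in_tuple p0);
      rewrite ep0 /=.
  have := nth_find 0 hasa; rewrite nth_iota ?add0n; last first.
    by rewrite -[ltnRHS](size_iota 0) -has_find.
  rewrite {1}/a /walk_of_length; case/existsP=> q /andP[eq /eqP lq].
  by exists q => //; split=> //; rewrite size_tuple.
case/shortenP: ep lp => q eq uq sub lq sp; exists q; split=> //.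
apply/eqP; rewrite eqn_leq -{2}lq dist_le_path // andbT -sp.
by apply: uniq_leq_size => //; case/andP: uq.
Qed.

End Distance.

(** * Descendants in a tree rooted at the spotter *)

Section Shadow.
Variables (V : finType) (e : rel V).

Definition avoid (w : V) : rel V := [rel x y | [&& x != w, y != w & e x y]].

(** In a tree rooted at [s], the strict descendants of [w]; this form makes
    the invariance under the moves of a robber who avoids [w] immediate. *)
Definition shadow (s w x : V) : bool := (x != w) && ~~ connect (avoid w) x s.

Definition branch (s c x : V) : bool := (x == c) || shadow s c x.

Lemma avoid_path w x p : path (avoid w) x p -> path e x p /\ w \notin p.
Proof.
elim: p x => //= y p IH x /andP[/and3P[_ yw exy] /IH[ep wp]].
by rewrite exy ep inE negb_or eq_sym yw.
Qed.

Lemma path_avoid w x p : path e x p -> w \notin x :: p -> path (avoid w) x p.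
Proof.
elim: p x => //= y p IH x /andP[exy ep].
rewrite !inE !negb_or => /and3P[xw yw wp].
rewrite {1}/avoid /= [x == w]eq_sym xw [y == w]eq_sym yw exy /=.
by rewrite IH // inE negb_or yw.
Qed.

Lemma connect_avoid_other c w x s : connect (avoid c) x s ->
  ~~ connect (avoid w) x s -> connect (avoid c) x w.
Proof.
case/connectP=> p ep ->; case: (boolP (w \in x :: p)) => [wp _|wp].
  by apply: path_connect wp.
case/negP; apply/connectP; exists p => //; apply: path_avoid wp.
by case/avoid_path: ep.
Qed.

Hypothesis treeE : tree e.

Let sym_e : symmetric e. Proof. by case: treeE => -[]. Qed.
Let conn x y : connect e x y. Proof. by case: treeE => _ []. Qed.

Lemma dist_sym x y : dist e x y = dist e y x.
Proof.
wlog suff le : x y / dist e x y <= dist e y x.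
  by apply/eqP; rewrite eqn_leq !le.
have [p [ep lp _ <-]] := geodesic (conn y x).
have : path e x (rev (belast y p)).
  by rewrite -lp rev_path; apply: sub_path ep => ? ?; rewrite sym_e.
move/dist_le_path; rewrite size_rev size_belast; congr (dist _ _ _ <= _).
by case: p {ep} lp => [/= ->|a p _] //=; rewrite rev_cons last_rcons.
Qed.

Lemma avoid_sym w : symmetric (avoid w).
Proof. by move=> x y; rewrite /avoid /= sym_e andbCA. Qed.

Lemma avoid_connectC w x y : connect (avoid w) x y = connect (avoid w) y x.
Proof. exact: (sym_connect_sym (avoid_sym w)). Qed.

(** Two neighbours of [c] joined by a path around [c] would close a cycle. *)
Lemma tree_neighbour_unique c g w :
  e c g -> e c w -> connect (avoid c) g w -> g = w.
Proof.
move=> ecg ecw /connectP[p ep wE]; move: ecw; rewrite wE => {w wE}.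
case/shortenP: ep => -[//|y {}p] ep up _ ecw; exfalso.
have [_ _ /(_ [:: c, g, y & p] isT)] := treeE; apply.
have cg : c != g by move: ep => /= /andP[/and3P[]]; rewrite eq_sym.
have [ep' cp] := avoid_path ep.
rewrite /ucycle; apply/andP; split; last first.
  by rewrite cons_uniq up inE negb_or cg cp.
by rewrite (cycle_path c) /= [e _ c]sym_e ecw ecg.
Qed.

(** The shadow of [w] is a union of components of the graph without [w]. *)
Lemma shadow_step s w x y :
  x != w -> y != w -> step e x y -> shadow s w x = shadow s w y.
Proof.
move=> xw yw /orP[/eqP-> //|exy]; rewrite /shadow xw yw /=; congr (~~ _).
by apply: (same_connect (sym_connect_sym (avoid_sym w))); apply: connect1;
   rewrite /avoid /= xw yw.
Qed.

Lemma branch_step s c x y : y != c ->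
  x != c -> branch s c x -> step e x y -> branch s c y.
Proof.
move=> yc xc; rewrite /branch (negbTE xc) (negbTE yc) /= => sx st.
by rewrite -(shadow_step s xc yc st).
Qed.

(** A geodesic from the shadow of [w] to [s] visits [w] on its way. *)
Lemma shadow_dist s w x : shadow s w x -> dist e w s < dist e x s.
Proof.
case/andP=> xw nc; have [p [ep lp _ <-]] := geodesic (conn x s).
have wp : w \in p.
  apply/negPn/negP => wp; case/negP: nc; apply/connectP; exists p => //.
  by apply: path_avoid => //; rewrite inE negb_or eq_sym xw.
case/splitPr: wp ep lp => p1 p2; rewrite cat_path last_cat /= => /and3P[_ _ ep].
move=> lp; rewrite -lp size_cat /= addnS ltnS.
by apply: leq_trans (dist_le_path ep) (leq_addl _ _).
Qed.

(** The neighbour [c] is the first step of the path from [w] to [x]; were [s]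
    on the side of [x] after the removal of [c], the path from [x] to [s]
    would meet [w], and [c] would have two neighbours joined around it. *)
Lemma shadow_branch s w x : shadow s w x ->
  exists c, [/\ e w c, shadow s w c & branch s c x].
Proof.
case/andP=> xw nc; have [p [ep lp up _]] := geodesic (conn w x).
case: p ep lp up => [_ /= xE|c p /= /andP[ewc ep] lp /andP[wp up]].
  by rewrite xE eqxx in xw.
move: wp; rewrite inE negb_or => /andP[wc wp].
have cx : connect (avoid w) c x.
  apply/connectP; exists p => //.
  by apply: path_avoid => //; rewrite inE negb_or wc.
exists c; split=> //.
  rewrite /shadow eq_sym wc; apply: contra nc; apply: connect_trans.
  by rewrite avoid_connectC.
rewrite /branch /shadow; case: eqVneq => //= xc; apply/negP => xs.
case: p ep lp up wp {cx} => [_ /= cE|g p /= /andP[ecg ep] lp /andP[cp _] gp].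
  by rewrite cE eqxx in xc.
move: gp; rewrite inE negb_or => /andP[/eqP gw _]; apply/gw/esym.
apply: (@tree_neighbour_unique c) => //; first by rewrite sym_e.
apply: (connect_trans (y := x)); last exact: connect_avoid_other xs nc.
by apply/connectP; exists p => //; apply: path_avoid.
Qed.

(** A robber who leaves the branch at [c] does it through the parent [w] of
    [c]: any other exit would be a second neighbour of [c] joined to [w] around
    [c]. *)
Lemma branch_closed s w c x y : e w c -> shadow s w c -> branch s c x ->
  y != w -> step e x y -> branch s c y.
Proof.
move=> ewc sc bx yw st; case: (eqVneq y c) => [->|yc].
  by rewrite /branch eqxx.
case: (eqVneq x c) bx st => [-> _|xc bx st]; last exact: branch_step st.
rewrite /step (negbTE yc) /= => ecy.
have := sc; rewrite (@shadow_step s w c y) //; last 2 first.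
- by case/andP: sc.
- by rewrite /step ecy orbT.
case/andP=> _ nyc; rewrite /branch /shadow yc /=; apply/orP; right.
apply/negP => ys; case/eqP: yw; apply: (@tree_neighbour_unique c) => //.
  by rewrite sym_e.
exact: connect_avoid_other ys nyc.
Qed.

(** Cutting the edge [z' z] of the path from [u] to [v] splits the tree in two
    parts. A vertex reached from [u] without meeting [z] is separated from [v]
    by [z']: otherwise it would be joined to [z] around [z'], and the
    last vertex before [z] on that path would be joined to [z'] around [z]. *)
Lemma shadow_opposite u v z z' x : e z z' ->
  connect (avoid z) z' u -> connect (avoid z') z v ->
  x != z -> x != z' -> ~~ shadow u z x -> shadow v z' x.
Proof.
move=> ezz z'u zv xz xz'; rewrite /shadow xz xz' /= negbK => xu.
apply/negP => xv.
have : connect (avoid z') z x.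
  by apply: connect_trans zv _; rewrite avoid_connectC.
case/connectP => p0 ep0; case/shortenP: ep0 => -[_ _ _ xE|y p].
  by rewrite xE eqxx in xz.
move=> ep /= /andP[zp _] _ xE.
have [/= /andP[ezy ep'] z'p] := avoid_path ep.
case/negP: z'p; rewrite inE; apply/orP; left; apply/eqP/esym.
apply: (@tree_neighbour_unique z) => //.
apply: (connect_trans (y := x)).
  by apply/connectP; exists p => //; apply: path_avoid.
by apply: connect_trans xu _; rewrite avoid_connectC.
Qed.

(** The edge [z' z] lies on a geodesic from [u] to [v], with [z] at distance
    [j] from [u]. *)
Lemma geodesic_edge u v j : 0 < j <= dist e u v -> exists z z',
  [/\ e z z', connect (avoid z) z' u /\ connect (avoid z') z v,
      j <= dist e z u & dist e u v - j < dist e z' v].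
Proof.
have [p [ep lp up sp]] := geodesic (conn u v) => /andP[j0 jd].
have jp : j.-1 < size p by rewrite sp prednK.
have := cat_take_drop j.-1 p; rewrite (drop_nth u jp) prednK //.
have := size_takel (ltnW jp); have := size_drop j p.
set z := nth u p j.-1; move: (take _ p) (drop j p) => p1 p2 s2 s1 pE.
move: ep lp up; rewrite -pE cat_path last_cat -cat_cons cat_uniq /=.
set z' := last u p1 => /and3P[e1 ez'z e2] lp.
case/and3P=> /andP[u1 u1'] /norP[nz n2] /andP[z2 u2].
have z'1 : z' \in u :: p1 by apply: mem_last.
exists z, z'; split; first by rewrite sym_e.
- split.
    rewrite avoid_connectC; apply/connectP; exists p1 => //.
    exact: path_avoid.
  apply/connectP; exists p2 => //; apply: path_avoid => //.
  rewrite inE negb_or; apply/andP; split.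
    by apply: contraNneq nz => <-.
  by apply: contra n2 => z'2; apply/hasP; exists z'.
- have [q [eq lq _ sq]] := geodesic (conn u z).
  have : path e u (q ++ p2) by rewrite cat_path eq lq.
  move/dist_le_path; rewrite last_cat lq lp size_cat s2 sq sp (dist_sym z u); lia.
- have [q [eq lq _ sq]] := geodesic (conn z' v).
  have : path e u (p1 ++ q) by rewrite cat_path e1.
  move/dist_le_path; rewrite last_cat -/z' lq size_cat s1 sq; lia.
Qed.

End Shadow.

(** * Search schedules *)

Section Schedules.
Variables (V : finType) (e : rel V) (I : finType).

Notation cops := {ffun I -> V}.
Notation play := (robber_play e).

Definition legal_moves (P : nat -> cops) : Prop :=
  forall t i, step e (P t i) (P t.+1 i).

Definition evades (a : seq I) (P : nat -> cops) (r : nat -> V) (L : nat) :=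
  forall t i, i \in a ->
    (t <= L -> P t i != r t) /\ (t < L -> P t.+1 i != r t).

(** A guard on a vibrating edge is at the blocked vertex at least every second
    time, and at the end. *)
Definition keeps (A : pred cops) (P : nat -> cops) (L : nat) : Prop :=
  A (P L) /\ forall t, t < L -> A (P t) || A (P t.+1).

Definition glue (L : nat) (P Q : nat -> cops) (t : nat) : cops :=
  if t <= L then P t else Q (t - L).

(** That [A] holds before and after makes clearings composable. *)
Definition clears (a : seq I) (A : pred cops) (X : pred V) : Prop :=
  forall c, A c -> exists P L,
    [/\ P 0 = c, legal_moves P, keeps A P L &
        forall r, play r -> evades a P r L -> ~ forall t, t <= L -> X (r t)].

Lemma step_refl x : step e x x. Proof. by rewrite /step eqxx. Qed.

Lemma evades_sub (a b : seq I) P r L M : {subset a <= b} -> M <= L ->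
  evades b P r L -> evades a P r M.
Proof.
move=> ab ML ev t i /ab /(ev t i)[h1 h2].
by split=> h; [apply: h1 | apply: h2]; apply: leq_trans ML.
Qed.

Lemma evades_ext (a : seq I) (P Q : nat -> cops) r L : (forall t i, i \in a -> P t i = Q t i) ->
  evades a P r L -> evades a Q r L.
Proof. by move=> PQ ev t i ia; rewrite -!PQ //; apply: ev. Qed.

Section Glue.
Variables (L : nat) (P Q : nat -> cops).
Hypothesis PQ : Q 0 = P L.

Lemma glue_left t : t <= L -> glue L P Q t = P t.
Proof. by rewrite /glue => ->. Qed.

Lemma glue_right t : glue L P Q (L + t) = Q t.
Proof.
rewrite /glue; case: t => [|t]; first by rewrite addn0 leqnn PQ.
by rewrite ifF; [congr Q; lia | lia].
Qed.

Lemma glue_legal : legal_moves P -> legal_moves Q -> legal_moves (glue L P Q).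
Proof.
move=> lP lQ t i; case: (ltnP t L) => [tL|Lt].
  by rewrite !glue_left // ltnW.
by rewrite -(subnKC Lt) -addnS !glue_right.
Qed.

Lemma glue_keeps A M : keeps A P L -> keeps A Q M -> keeps A (glue L P Q) (L + M).
Proof.
move=> [AP kP] [AQ kQ]; split; first by rewrite glue_right.
move=> t tLM; case: (ltnP t L) => [tL|Lt].
  by rewrite !glue_left ?kP // ltnW.
by rewrite -(subnKC Lt) -addnS !glue_right; apply: kQ; lia.
Qed.

Lemma glue_evadesl a r M : evades a (glue L P Q) r (L + M) -> evades a P r L.
Proof.
move=> ev t i ia; have [h1 h2] := ev t i ia.
split=> tL; [have := h1 | have := h2]; rewrite glue_left ?(ltnW tL) //;
  by apply; lia.
Qed.

Lemma glue_evadesr a r M :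
  evades a (glue L P Q) r (L + M) -> evades a Q (fun t => r (L + t)) M.
Proof.
move=> ev t i ia; have [h1 h2] := ev (L + t) i ia; rewrite -addnS in h2.
rewrite !glue_right in h1 h2.
by split=> tM; [apply: h1 | apply: h2]; lia.
Qed.

End Glue.

Lemma play_shift r L : play r -> play (fun t => r (L + t)).
Proof. by move=> pr t; rewrite addnS. Qed.

(** A robber who never leaves his region is caught while that region is being
    cleared, whatever happens meanwhile to the other regions. *)
Lemma clears_each (T : eqType) a A (X : T -> pred V) (l : seq T) c :
    (forall x, x \in l -> clears a A (X x)) -> A c ->
  exists P L, [/\ P 0 = c, legal_moves P, keeps A P L &
    forall r x, play r -> evades a P r L -> x \in l ->
      ~ forall t, t <= L -> X x (r t)].
Proof.
elim: l c => [|y l IH] c cl Ac.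
  exists (fun _ => c), 0; split=> //.
  by move=> t i; apply: step_refl.
have [P [L [P0 lP kP PX]]] := cl y (mem_head _ _) c Ac.
have [|Q [M [Q0 lQ kQ QX]]] := IH (P L) _ (proj1 kP).
  by move=> x xl; apply: cl; rewrite inE xl orbT.
exists (glue L P Q), (L + M); split.
- by rewrite glue_left.
- exact: glue_legal.
- exact: glue_keeps.
move=> r x pr ev; rewrite inE => /predU1P[->|xl] rX.
  apply: (PX r pr (glue_evadesl ev)) => t tL; apply: rX; lia.
apply: (QX _ x (play_shift L pr) (glue_evadesr Q0 ev) xl) => t tM.
by apply: rX; lia.
Qed.

Definition move_to (i : I) (x : V) (c : cops) : cops :=
  [ffun j => if j == i then x else c j].

Lemma walk_to (i : I) y (c : cops) : connect e (c i) y -> exists P L,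
  [/\ P 0 = c, legal_moves P & P L i = y].
Proof.
case/connectP => p; elim: p c => [|x p IH] c /= ep yE.
  by rewrite yE; exists (fun _ => c), 0; split=> // t j; apply: step_refl.
case/andP: ep => ex ep.
have [||P [L [P0 lP PL]]] := IH (move_to i x c); rewrite ?ffunE ?eqxx //.
exists (fun t => if t is t'.+1 then P t' else c), L.+1; split=> // -[|t] j //.
rewrite P0 ffunE; case: eqP => [->|_]; last exact: step_refl.
by rewrite /step ex orbT.
Qed.

(** A guard who never leaves [w] for two turns in a row blocks [w]: a robber
    there meets the guard standing on it or coming back to it. *)
Lemma guard_blocks_before a i0 w P r L M t : i0 \in a -> evades a P r M ->
  keeps (fun c : cops => c i0 == w) P L -> t < M <= L -> r t != w.
Proof.
move=> ia ev [_ kP] /andP[tM ML]; have [h1 h2] := ev t i0 ia.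
case/orP: (kP t (leq_trans tM ML)) => /eqP <-; rewrite eq_sym.
  by apply: h1; apply: ltnW.
exact: h2.
Qed.

Lemma guard_blocks a i0 w P r L t : i0 \in a -> evades a P r L ->
  keeps (fun c : cops => c i0 == w) P L -> t <= L -> r t != w.
Proof.
move=> ia ev kP; rewrite leq_eqVlt => /predU1P[->|tL].
  have [kL _] := kP; have [h _] := ev L i0 ia.
  by move: (h (leqnn L)); rewrite (eqP kL) eq_sym.
by apply: (guard_blocks_before ia ev kP); rewrite tL /=.
Qed.

End Schedules.

(** * Searching the invisible part of a subtree *)

Section Clearing.
Variables (V : finType) (e : rel V) (I : finType) (k : nat) (s : V).
Hypothesis treeE : tree e.

Notation cops := {ffun I -> V}.
Notation play := (robber_play e).
Notation near x := (dist e x s <= k).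
Notation guarding i w := (fun c : cops => c i == w).

Lemma shadow_play w r L : play r -> (forall t, t <= L -> r t != w) ->
  forall t, t <= L -> shadow e s w (r t) = shadow e s w (r 0).
Proof.
move=> pr rw; elim=> // t IH tL; rewrite -IH ?(ltnW tL) //.
by apply/esym/shadow_step => //; apply: rw; rewrite // ltnW.
Qed.

Lemma branch_play w c r L : e w c -> shadow e s w c -> play r ->
  (forall t, t <= L -> r t != w) -> branch e s c (r 0) ->
  forall t, t <= L -> branch e s c (r t).
Proof.
move=> ewc sc pr rw b0; elim=> // t IH tL.
by apply: (branch_closed treeE ewc sc (IH (ltnW tL))) => //; apply: rw.
Qed.

(** The guard can be brought to [w] first; a robber of the branch at [w] is
    then in the shadow of [w] for good. *)
Lemma clears_branch i0 a w :
    clears e (i0 :: a) (guarding i0 w)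
      (fun x => shadow e s w x && near x) ->
  clears e (i0 :: a) predT (fun x => branch e s w x && near x).
Proof.
move=> cl c _.
have [|P [L [P0 lP PL]]] := @walk_to _ e _ i0 w c.
  by case: treeE => _ [].
have [|Q [M [Q0 lQ kQ QX]]] := cl (P L); first by rewrite /= PL.
exists (glue L P Q), (L + M); split.
- by rewrite glue_left.
- exact: glue_legal.
- by [].
move=> r pr ev rX; have evQ := glue_evadesr Q0 ev.
apply: (QX _ (play_shift L pr) evQ) => t tM.
have rw := guard_blocks (mem_head _ _) evQ kQ tM.
have /andP[] : branch e s w (r (L + t)) && near (r (L + t)).
  by apply: rX; lia.
by rewrite /branch (negbTE rw) => /= -> ->.
Qed.

Definition vibrate (i0 : I) (w c : V) (P : nat -> cops) (t : nat) : cops :=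
  move_to i0 (if odd t then c else w) (P t).

(** A guard going back and forth along the edge [w c] blocks both of its ends,
    so that a robber of the branch at [c] stays strictly below [c] while the
    rest of the team works there. *)
Lemma clears_child i0 a w c : i0 \notin a -> e w c -> shadow e s w c ->
    (forall p, exists P L, [/\ P 0 = p, legal_moves e P &
      forall r, play r -> evades a P r L ->
        (forall t, t <= L -> r t != c) ->
        ~ forall t, t <= L -> shadow e s c (r t) && near (r t)]) ->
  clears e (i0 :: a) (guarding i0 w) (fun x => branch e s c x && near x).
Proof.
move=> i0a ewc sc sub p /eqP pw.
have [P [L [P0 lP PX]]] := sub p.
pose Q := vibrate i0 w c P.
have Q0 t : Q t i0 = if odd t then c else w by rewrite ffunE eqxx.
have Qa t i : i \in a -> Q t i = P t i.
  by move=> ia; rewrite ffunE; case: eqP => // ii0; rewrite -ii0 ia in i0a.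
(* An even length brings the guard back to [w]; it is positive so that the
   guard does visit [c]. *)
exists Q, L.*2.+2; split.
- by apply/ffunP => i; rewrite ffunE P0; case: eqP => // ->.
- move=> t i; rewrite !ffunE; case: eqP => [_|_]; last exact: lP.
  rewrite /step /=; case: (odd t) => /=; last by rewrite ewc orbT.
  by have [[sym _] _ _] := treeE; rewrite sym ewc orbT.
- split; first by rewrite /= Q0 /= odd_double.
  by move=> t _; rewrite /= !Q0 /=; case: odd; rewrite eqxx ?orbT.
move=> r pr ev rX.
have rc t : t <= L -> r t != c.
  move=> tL; have [] := ev t i0 (mem_head _ _); rewrite !Q0 /= => h1 h2.
  have {}h1 := h1 ltac:(lia); have {}h2 := h2 ltac:(lia).
  by move: h1 h2; case: odd => /= h1 h2; rewrite eq_sym.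
apply: (PX r pr _ rc).
  apply: (@evades_ext _ _ a Q) => //; apply: evades_sub ev; last by lia.
  by move=> i ia; rewrite inE ia orbT.
move=> t tL; have /andP[] : branch e s c (r t) && near (r t).
  by apply: rX; lia.
by rewrite /branch (negbTE (rc t tL)) => /= -> ->.
Qed.

(** Every cop beyond the guard buys two more levels, because the guard blocks
    a vertex together with one of its children. The spotter at [s] confines
    an unseen robber to the vertices at distance at most [k] from [s]. *)
Lemma clears_shadow i0 a w : uniq (i0 :: a) ->
  k <= dist e w s + (size a).*2.+1 ->
  clears e (i0 :: a) (guarding i0 w) (fun x => shadow e s w x && near x).
Proof.
have [n] := ubnP (size a); elim: n i0 a w => // n IH i0 a w sa /andP[i0a ua] kw.
pose l := [seq c <- enum V | e w c && shadow e s w c].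
have phase c : c \in l ->
    clears e (i0 :: a) (guarding i0 w) (fun x => branch e s c x && near x).
  rewrite mem_filter => /andP[/andP[ewc sc] _]; apply: clears_child => // p.
  have dc := shadow_dist treeE sc.
  case: a sa i0a ua kw => [_ _ _ kw|i1 a sa _ ua kw].
    exists (fun _ => p), 0; split=> //.
      by move=> t i; apply: step_refl.
    move=> r _ _ _ /(_ 0 isT)/andP[/(shadow_dist treeE) d0 n0].
    by move: kw => /=; lia.
  pose l' := [seq g <- enum V | e c g && shadow e s c g].
  have [g|//|P [L [P0 lP _ PX]]] := @clears_each _ e _ _ (i1 :: a) predT
    (fun g x => branch e s g x && near x) l' p.
    rewrite mem_filter => /andP[/andP[_ sg] _].
    apply/clears_branch/IH => //.
    by have := shadow_dist treeE sg; move: kw => /=; lia.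
  exists P, L; split=> // r pr ev rc rX.
  have /andP[s0 _] := rX 0 isT; have [g [ecg sg bg]] := shadow_branch treeE s0.
  apply: (PX r g pr ev) => [|t tL].
    by rewrite mem_filter ecg sg mem_enum.
  have /andP[_ ->] := rX t tL.
  by rewrite andbT; apply: branch_play (ecg) _ _ rc _ _ tL.
move=> p pw; have [P [L [P0 lP kP PX]]] := clears_each phase pw.
exists P, L; split=> // r pr ev rX.
have /andP[s0 _] := rX 0 isT; have [c [ewc sc bc]] := shadow_branch treeE s0.
apply: (PX r c pr ev) => [|t tL].
  by rewrite mem_filter ewc sc mem_enum.
have /andP[_ ->] := rX t tL; rewrite andbT.
apply: branch_play (ewc) _ _ _ _ _ tL => // t' t'L.
exact: guard_blocks (mem_head _ _) ev kP t'L.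
Qed.

End Clearing.

(** * The game on the knowledge of the cops *)

Section Knowledge.
Variables (V : finType) (e : rel V) (k m : nat).

Notation cops := {ffun 'I_m -> V}.
Notation play := (robber_play e).

Definition legal_move (c c' : cops) : bool := [forall i, step e (c i) (c' i)].

Definition free (c : cops) (x : V) : bool := [forall i, c i != x].

Definition consistent (c : cops) (o : option V) (S : {set V}) : {set V} :=
  [set x in S | free c x && ((view_of e k c x).2 == o)].

Definition spread (c : cops) (S : {set V}) : {set V} :=
  [set y | [exists x in S, free c x && step e x y]].

(** The cops stand at [c], they know that the robber is in [S], and they are
    about to look; they then have a choice of moves that leads to a capture
    within [n] rounds. *)
Fixpoint wins_within (n : nat) (c : cops) (S : {set V}) : bool :=
  if n is n'.+1 then
    [forall o, [exists c', legal_move c c' &&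
      wins_within n' c' (spread c' (consistent c o S))]]
  else S == set0.

Definition wins (c : cops) (S : {set V}) : Prop := exists n, wins_within n c S.

Lemma freeP (c : cops) x : reflect (forall i, c i != x) (free c x).
Proof. exact: forallP. Qed.

Lemma consistentS (c : cops) o (S S' : {set V}) :
  S \subset S' -> consistent c o S \subset consistent c o S'.
Proof.
move=> /subsetP SS; apply/subsetP => x; rewrite !inE => /andP[/SS -> ->] //.
Qed.

Lemma spreadS (c : cops) (S S' : {set V}) : S \subset S' -> spread c S \subset spread c S'.
Proof.
move=> /subsetP SS; apply/subsetP => x; rewrite !inE.
case/existsP=> y /andP[/SS yS h]; apply/existsP; exists y; by rewrite yS.
Qed.

Lemma wins_withinS n (c : cops) (S S' : {set V}) :
  S \subset S' -> wins_within n c S' -> wins_within n c S.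
Proof.
elim: n c S S' => [|n IH] c S S' SS /=.
  by move/eqP => S0; rewrite -subset0 -S0.
move/forallP => W; apply/forallP => o.
have /existsP[c' /andP[lc Wc]] := W o.
apply/existsP; exists c'; rewrite lc /=.
by apply: IH Wc; apply/spreadS/consistentS.
Qed.

Lemma legal_move_refl c : legal_move c c.
Proof. by apply/forallP => i; apply: step_refl. Qed.

Lemma wins_withinW n n' c S : n <= n' -> wins_within n c S ->
  wins_within n' c S.
Proof.
elim: n n' c S => [|n IH] [|n'] c S // nn'.
  move/eqP => ->; elim: n' c {nn'} => [|n' IH'] c.
    apply/forallP => o; apply/existsP; exists c; rewrite legal_move_refl /=.
    rewrite -subset0; apply/subsetP => y; rewrite !inE.
    by case/existsP=> x; rewrite !inE.
  apply/forallP => o; apply/existsP; exists c; rewrite legal_move_refl.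
  apply: wins_withinS (IH' c); apply/subsetP => y; rewrite !inE.
  by case/existsP=> x; rewrite !inE.
move/forallP => W; apply/forallP => o.
have /existsP[c' /andP[lc Wc]] := W o.
by apply/existsP; exists c'; rewrite lc /=; apply: IH Wc.
Qed.

Lemma winsS c (S S' : {set V}) : S \subset S' -> wins c S' -> wins c S.
Proof. by move=> SS [n W]; exists n; apply: wins_withinS W. Qed.

Lemma wins_move c c' (S S' : {set V}) : legal_move c c' ->
    (forall x y, x \in S -> free c' x -> free c' y -> step e x y -> y \in S') ->
  wins c' S' -> wins c S.
Proof.
move=> lc SS' [n W]; exists n.+2; apply/forallP => o; apply/existsP; exists c'.
rewrite lc; apply/forallP => o'.
have /forallP/(_ o')/existsP[c2 /andP[lc2 W2]] := wins_withinW (leqnSn n) W.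
apply/existsP; exists c2; rewrite lc2 /=; apply: wins_withinS W2.
apply: spreadS; apply/subsetP => y; rewrite !inE.
case/andP=> /existsP[x]; rewrite inE => /andP[/andP[xS _] /andP[fx xy]].
by case/andP=> fy ->; rewrite fy (SS' x).
Qed.

(** Cop [i] watches the vertices at distance more than [k]. Finitely many
    vertices may be seen, hence a common bound on the number of rounds. *)
Lemma wins_look (i : 'I_m) c (S : {set V}) :
    (forall x, x \in S -> free c x -> k < dist e x (c i) -> wins c [set x]) ->
    wins c [set x in S | free c x && (dist e x (c i) <= k)] ->
  wins c S.
Proof.
move=> far [n0 Wnear].
have [f fP] : exists f : V -> nat, forall x,
    [&& x \in S, free c x & k < dist e x (c i)] ->
    wins_within (f x) c [set x].
  apply: (@fin_all_exists V (fun=> nat) (fun x n =>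
    [&& x \in S, free c x & k < dist e x (c i)] -> wins_within n c [set x])) => x.
  case: (boolP [&& _, _ & _]) => [/and3P[xS fx dx]|_]; last by exists 0.
  by have [n Wn] := far x xS fx dx; exists n.
pose n := maxn n0 (\max_x f x); exists n.+1.
apply/forallP => o.
case: (pickP [pred x in consistent c o S | k < dist e x (c i)]) => [x|none].
  rewrite inE => /andP[xo dx].
  move: (xo); rewrite inE => /andP[xS /andP[fx /eqP xo']].
  have Wx : wins_within n.+1 c [set x].
    apply: (@wins_withinW (f x)); last by apply: fP; rewrite xS fx.
    by rewrite leqW // leq_max leq_bigmax orbT.
  have /forallP/(_ o)/existsP[c' /andP[lc W]] := Wx.
  apply/existsP; exists c'; rewrite lc /=; apply: wins_withinS W.
  apply: spreadS; apply/subsetP => y; rewrite !inE => /andP[_ /andP[fy yo]].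
  rewrite fy yo !andbT; move: yo; rewrite -xo' /=.
  have -> : invisible e k c x = false.
    by apply/negP => /forallP/(_ i) /andP[_]; rewrite leqNgt dx.
  by case: ifP => // _ /eqP[->].
have /forallP/(_ o)/existsP[c' /andP[lc W]] : wins_within n.+1 c
    [set x in S | free c x && (dist e x (c i) <= k)].
  by apply: wins_withinW Wnear; rewrite leqW // leq_maxl.
apply/existsP; exists c'; rewrite lc /=; apply: wins_withinS W.
apply: spreadS; apply/subsetP => y yo; have := none y.
move: (yo); rewrite !inE => /andP[yS /andP[fy ->]].
by rewrite yS fy /= !andbT => /negbT; rewrite -leqNgt.
Qed.

(** While the cops carry out a schedule, the possible robbers are the walks
    that have evaded them and that cop [i] has not seen. *)
Lemma wins_run (i : 'I_m) P L (S Q : {set V}) : legal_moves e P ->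
    (forall r t, play r -> r 0 \in S -> t <= L ->
       evades (enum 'I_m) P r t -> k < dist e (r t) (P t i) ->
       wins (P t) [set r t]) ->
    (forall r, play r -> r 0 \in S -> evades (enum 'I_m) P r L ->
       (forall t, t <= L -> dist e (r t) (P t i) <= k) -> r L \in Q) ->
  wins (P L) Q -> wins (P 0) S.
Proof.
elim: L P S => [|L IH] P S lP far near WQ;
  apply: (@wins_look i) => [x xS fx dx|].
- apply: (far (fun=> x) 0) => //; first by move=> ?; apply: step_refl.
  by move=> t j _; split=> //; rewrite leqn0 => /eqP->; apply: (freeP _ _ fx).
- apply: winsS WQ; apply/subsetP => x; rewrite inE => /andP[xS /andP[fx dx]].
  apply: (near (fun=> x)) => //; first by move=> ?; apply: step_refl.
    by move=> t j _; split=> //; rewrite leqn0 => /eqP->; apply: (freeP _ _ fx).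
  by move=> t; rewrite leqn0 => /eqP->.
- apply: (far (fun=> x) 0) => //; first by move=> ?; apply: step_refl.
  by move=> t j _; split=> //; rewrite leqn0 => /eqP->; apply: (freeP _ _ fx).
set S1 := [set x in S | _].
pose S2 := [set y | free (P 1) y && [exists x in S1, free (P 1) x && step e x y]].
apply: (@wins_move _ (P 1) _ S2); first by apply/forallP => j; apply: lP.
  move=> x y xS fx fy xy; rewrite inE fy; apply/existsP; exists x.
  by rewrite xS fx.
have pre r n : r 0 \in S2 -> play r -> evades (enum 'I_m) (fun t => P t.+1) r n ->
    exists x, let r' t := if t is t'.+1 then r t' else x in
    [/\ play r', x \in S, dist e x (P 0 i) <= k
       & evades (enum 'I_m) P r' n.+1].
  rewrite inE => /andP[f1 /existsP[x]].
  rewrite inE => /andP[/andP[xS /andP[f0 d0]] /andP[fx xr]] pr ev.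
  exists x; split=> //; first by case.
  move=> [|t] j js; last by apply: ev.
  by split=> _; apply/freeP.
apply: (IH (fun t => P t.+1)) => // [r t pr r0 tL ev dr|r pr r0 ev dr].
- have [x [pr' xS _ ev']] := pre r t r0 pr ev.
  exact: (far _ t.+1 pr').
- have [x [pr' xS dx ev']] := pre r L r0 pr ev.
  by apply: (near _ pr' xS ev') => -[|t] // tL; apply: dr.
Qed.

Fixpoint knowledge (h : seq (view V m)) : {set V} :=
  if h is v :: _ :: h' then
    let v' := head v h' in spread v.1 (consistent v'.1 v'.2 (knowledge h'))
  else setT.

(** The cops recompute from the views what they know and follow [wins_within].
    Every round adds two views to the history, so that its length tells them
    the number of rounds left. *)
Definition knowledge_strategy (n : nat) (c : cops) : strategy V m := fun h =>
  if h is v :: _ then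
    odflt v.1 [pick c' | legal_move v.1 c' &&
      wins_within (n - (size h)./2).-1 c'
        (spread c' (consistent v.1 v.2 (knowledge h)))]
  else c.

Lemma cops_win_wins c : wins c setT -> cops_win e k m.
Proof.
case=> n W; exists (knowledge_strategy n c); set s := knowledge_strategy n c.
split=> [v h i|r pr].
  rewrite /s /knowledge_strategy; case: pickP => [c' /andP[/forallP lc _]|_] /=.
    exact: lc.
  exact: step_refl.
apply: boolp.contrapT => nc.
have ev t i : cops_at e k s r t i != r t /\ cops_at e k s r t.+1 i != r t.
  by split; apply/eqP => E; apply: nc; exists t, i; [left | right].
have sz t : (size (history e k s r t))./2 = t.
  have -> : size (history e k s r t) = t.*2.+1.
    by elim: t => //= t ->; rewrite doubleS.
  by rewrite /= uphalf_double.
have hd t : exists h,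
    history e k s r t = view_of e k (cops_at e k s r t) (r t) :: h.
  by case: t => [|t]; eexists; reflexivity.
have inv t : t <= n ->
    wins_within (n - t) (cops_at e k s r t) (knowledge (history e k s r t)) /\
    r t \in knowledge (history e k s r t).
  elim: t => [|t IH] tn; first by rewrite subn0 inE.
  have [Wt rt] := IH (ltnW tn).
  set h := history e k s r t in Wt rt *.
  set ct := cops_at e k s r t in Wt *.
  have [h' hE] := hd t.
  have nE : n - t = (n - t.+1).+1 by lia.
  have wE : (n - (size h)./2).-1 = n - t.+1 by rewrite sz nE.
  pose o := (view_of e k ct (r t)).2.
  have kE : knowledge (history e k s r t.+1) =
      spread (s h) (consistent ct o (knowledge h)).
    have hh v : head v h = view_of e k ct (r t) by rewrite /h hE.
    by rewrite /= -/h hh.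
  have rc : r t \in consistent ct o (knowledge h).
    by rewrite inE rt eqxx andbT; apply/freeP => i; case: (ev t i).
  have r1 : r t.+1 \in spread (s h) (consistent ct o (knowledge h)).
    rewrite inE; apply/existsP; exists (r t); rewrite rc /=.
    by apply/andP; split; [apply/freeP => i; case: (ev t i) | apply: pr].
  rewrite kE; split=> //=; rewrite -/h.
  have -> : s h = odflt ct [pick c' | legal_move ct c' &&
      wins_within (n - t.+1) c' (spread c' (consistent ct o (knowledge h)))].
    by rewrite -wE /s /knowledge_strategy {1}/h hE.
  case: pickP => [c' /andP[_ //]|none] /=.
  move: Wt; rewrite nE => /forallP/(_ o)/existsP[c']; by rewrite none.
have [] := inv n (leqnn n); rewrite subnn /= => /eqP->; by rewrite inE.
Qed.

End Knowledge.

(** * Hunting down the robber *)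

Section Hunt.
Variables (V : finType) (e : rel V) (k m : nat).
Hypothesis treeE : tree e.

Notation cops := {ffun 'I_m -> V}.
Notation wins := (wins e k).

Lemma move_to_other (i j : 'I_m) x (c : cops) :
  j != i -> move_to i x c j = c j.
Proof. by rewrite ffunE => /negbTE->. Qed.

Lemma move_to_legal (i : 'I_m) x (c : cops) :
  step e (c i) x -> legal_move e c (move_to i x c).
Proof.
move=> cx; apply/forallP => j; rewrite ffunE; case: eqP => [->//|_].
exact: step_refl.
Qed.

Lemma guard_descends (i0 i : 'I_m) s w c (p : cops) (S : {set V}) : i != i0 ->
    (forall (p : cops) (S : {set V}), p i = s -> p i0 = c ->
      (forall x, x \in S -> shadow e s c x) -> wins p S) ->
    e w c -> p i = s -> p i0 = w -> (forall x, x \in S -> branch e s c x) ->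
  wins p S.
Proof.
move=> ii0 Wc ewc pi pw SB.
apply: (@wins_move _ _ _ _ _ (move_to i0 c p) _ [set x | shadow e s c x]).
- by apply: move_to_legal; rewrite pw /step ewc orbT.
- move=> x y xS /freeP/(_ i0) xc /freeP/(_ i0) yc xy.
  rewrite ffunE eqxx eq_sym in xc; rewrite ffunE eqxx eq_sym in yc.
  have := branch_step treeE yc xc (SB x xS) xy.
  by rewrite /branch (negbTE yc) inE.
- apply: Wc; first by rewrite move_to_other.
    by rewrite ffunE eqxx.
  by move=> x; rewrite inE.
Qed.

(** The guard is at [w] and the spotter at [s]. If the robber is in the shadow
    of [w], the schedule of [clears_shadow] catches him unless the spotter
    sees him, in which case the guard goes to the child of [w] on his side.
    The flag [out] tells whether he may also be elsewhere: this is so at the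
    start of the game, and no longer so once he is known to be below [w]. *)
Lemma wins_guarded (i0 : 'I_m) a i s w (out : bool) :
    uniq (i0 :: a) -> i \notin i0 :: a ->
    k <= dist e w s + (size a).*2.+1 ->
    (forall c (p : cops) (S : {set V}), e w c -> shadow e s w c -> p i = s -> p i0 = c ->
      (forall x, x \in S -> shadow e s c x) -> wins p S) ->
    (forall p : cops, p i = s -> p i0 = w ->
      wins p [set x | [&& x != w, ~~ shadow e s w x & out]]) ->
  forall (p : cops) (S : {set V}), p i = s -> p i0 = w ->
    (forall x, x \in S -> (x != w) && (shadow e s w x || out)) -> wins p S.
Proof.
move=> ua ia kw Win Wout p S pi pw SB.
have ii0 : i != i0 by apply: contraNneq ia => ->; apply: mem_head.
have [P [L [P0 lP kP PX]]] := clears_shadow treeE ua kw (introT eqP pw).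
pose P' t := move_to i s (P t).
have P'i t : P' t i = s by rewrite ffunE eqxx.
have P'E t j : j != i -> P' t j = P t j by apply: move_to_other.
have P'a t j : j \in i0 :: a -> P t j = P' t j.
  by move=> ja; rewrite P'E //; apply: contraNneq ia => <-.
have lP' : legal_moves e P'.
  by move=> t j; rewrite !ffunE; case: eqP => // _; apply: step_refl.
have P'0 : P' 0 = p.
  by apply/ffunP => j; rewrite ffunE P0; case: eqP => // ->.
have evP r t : evades (enum 'I_m) P' r t -> evades (i0 :: a) P r t.
  move=> ev; apply: (@evades_ext _ _ _ P'); first by move=> ? ? /P'a.
  by apply: evades_sub ev => // j _; rewrite mem_enum.
have P'0i t : P' t i0 = P t i0 by rewrite P'E // eq_sym.
have back t : t <= L -> P t i0 != w -> P' t.+1 i0 = w.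
  rewrite P'0i leq_eqVlt => /predU1P[->|tL ntw]; first by case: kP => ->.
  by case: kP => _ /(_ t tL); rewrite (negbTE ntw) => /eqP.
have legal t : legal_move e (P' t) (P' t.+1).
  by apply/forallP => j; apply: lP'.
have seen y t : t <= L -> P t i0 != y -> (y != w -> shadow e s w y || out) ->
    wins (P' t) [set y].
  (* A guard away from [w] first comes back to it, and meets a robber who is
     just entering [w]. *)
  move=> tL yP so; case: (eqVneq y w) => [yw|yw].
    apply: (@wins_move _ _ _ _ _ (P' t.+1) _ set0) => // [x z|]; last first.
      by exists 0; rewrite /= eqxx.
    rewrite inE yw in yP * => /eqP-> /freeP/(_ i0).
    by rewrite back ?eqxx.
  have gw z : free (P' t.+1) z -> P t i0 != w -> z != w.
    by move=> /freeP/(_ i0) h tw; rewrite eq_sym -(back t).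
  case: (boolP (shadow e s w y)) (so yw) => [sy _|nsy /= outT].
    have [c [ewc sc bc]] := shadow_branch treeE sy.
    have Wc := guard_descends ii0 (fun p S => Win c p S ewc sc) ewc.
    case: (eqVneq (P t i0) w) => tw.
      by apply: Wc; rewrite ?P'i ?P'0i // => x; rewrite inE => /eqP->.
    apply: (@wins_move _ _ _ _ _ (P' t.+1) _ [set x | branch e s c x]) => //.
      move=> x z; rewrite !inE => /eqP-> _ fz.
      by apply: branch_closed ewc sc bc _ => //; apply: gw.
    by apply: Wc; rewrite ?P'i ?back // => x; rewrite inE.
  case: (eqVneq (P t i0) w) => tw.
    apply: winsS (Wout (P' t) _ _); rewrite ?P'i ?P'0i //.
    by rewrite sub1set inE yw nsy.
  apply: (@wins_move _ _ _ _ _ (P' t.+1)) (Wout _ _ _); rewrite ?P'i ?back //.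
  move=> x z; rewrite !inE => /eqP-> _ /gw/(_ tw) zw yz.
  by rewrite zw outT -(shadow_step treeE s yw zw yz) nsy.
have confined r t : t <= L -> robber_play e r -> r 0 \in S ->
    evades (enum 'I_m) P' r t -> r t != w ->
    (forall t', t' <= t -> shadow e s w (r t') = shadow e s w (r 0)) /\
    (shadow e s w (r t) || out).
  move=> tL pr r0 ev rw.
  have sh := @shadow_play _ e s treeE w r t pr.
  have {}sh : forall t', t' <= t -> shadow e s w (r t') = shadow e s w (r 0).
    apply: sh => t'; rewrite leq_eqVlt => /predU1P[-> //|t't].
    by apply: (guard_blocks_before (mem_head _ _) (evP r t ev) kP); rewrite t't.
  by split=> //; rewrite sh //; case/andP: (SB _ r0).
rewrite -P'0.
apply: (@wins_run _ e k m i P' L S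
          [set x | [&& x != w, ~~ shadow e s w x & out]]) => //.
- move=> r t pr r0 tL ev _; apply: seen => //.
  + by rewrite -P'0i; have [] := ev t i0 (mem_enum _ _) => ->.
  + by move=> rw; have [] := confined r t tL pr r0 ev rw.
- move=> r pr r0 ev dr.
  have rw := guard_blocks (mem_head _ _) (evP r L ev) kP (leqnn L).
  have [sh so] := confined r L (leqnn L) pr r0 ev rw.
  rewrite inE rw /=; case: (boolP (shadow _ _ _ _)) so => //= sL _.
  case: (PX r pr (evP r L ev)) => t tL.
  by rewrite sh // -(sh L) // sL -(P'i t) dr.
- by apply: Wout => //; rewrite P'0i; case: kP => /eqP.
Qed.


(** A robber in the shadow of the guard is driven down the tree: each time he
    is seen the guard descends, and between two sightings the team sweeps. *)
Lemma wins_shadow (i0 : 'I_m) a i s w (p : cops) (S : {set V}) :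
    uniq (i0 :: a) -> i \notin i0 :: a ->
    k <= dist e w s + (size a).*2.+1 -> p i = s -> p i0 = w ->
  (forall x, x \in S -> shadow e s w x) -> wins p S.
Proof.
move=> ua ia; have [n] := ubnP (#|V| - dist e w s).
elim: n w p S => // n IH w p S nV kw pi pw SB.
apply: (@wins_guarded i0 a i s w false) => // [c q T ewc sc qi qc TB|q _ _|x].
- have := shadow_dist treeE sc; have := dist_le_card e c s => dV dc.
  by apply: (IH c) => //; lia.
- exists 0; rewrite /= -subset0; apply/subsetP => x.
  by rewrite inE !andbF.
- by move=> xS; have sx := SB x xS; rewrite sx andbT; case/andP: sx.
Qed.

(** A cop travels while the guard stands at [w]: what the cops know about the
    side of the robber remains true. *)
Lemma wins_travel (i0 i1 : 'I_m) v w (X : pred V) :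
    i1 != i0 ->
    (forall x y, X x -> x != w -> y != w -> step e x y -> X y) ->
    (forall p : cops, p i0 = w -> p i1 = v -> wins p [set x | (x != w) && X x]) ->
  forall p : cops, p i0 = w -> wins p [set x | (x != w) && X x].
Proof.
move=> i10 Xstep Wv p pw; have [_ [_ conn] _] := treeE.
have [q eq lq] := connectP (conn (p i1) v); elim: q p pw eq lq => [|x q IH] p pw.
  by move=> _ /= vE; apply: Wv.
move=> /= /andP[px eq] lq; have i01 : i0 != i1 by rewrite eq_sym.
have pw' : move_to i1 x p i0 = w by rewrite move_to_other.
have := IH (move_to i1 x p) pw'; rewrite {1 2}/move_to ffunE eqxx.
move=> /(_ eq lq); apply: wins_move.
  by apply: move_to_legal; rewrite /step px orbT.
move=> y z; rewrite !inE => /andP[yw Xy] _ /freeP/(_ i0); rewrite pw' eq_sym.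
by move=> zw yz; rewrite zw (Xstep y).
Qed.

End Hunt.

(** The spotter at [u] and the guard at [z] separate the robber from one side
    of the edge [z' z]. When he is known to be on the side of [u], a cop goes
    to [v] and takes over the watch, which frees the cop of [u], and the guard
    steps to [z']: the situation is that of [wins_shadow] seen from [v]. *)
Lemma tree_cops_win (V : finType) (e : rel V) (k n j : nat) (u v : V) :
    tree e -> 0 < n -> 0 < j <= dist e u v ->
    k <= j + n.*2.+1 -> k <= (dist e u v - j).+1 + n.*2.+1 ->
  cops_win e k n.+2.
Proof.
move=> treeE n0 jd kj kd.
have [z [z' [ezz' [z'u zv] zj z'j]]] := geodesic_edge treeE jd.
pose i : 'I_n.+2 := inord 0; pose i0 : 'I_n.+2 := inord 1.
pose i1 : 'I_n.+2 := inord 2.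
have ij : [/\ i != i0, i1 != i0 & i1 != i].
  by rewrite -!val_eqE /= !inordK //; lia.
case: ij => ii0 i10 i1i.
pose team (l : 'I_n.+2) := [seq x <- enum 'I_n.+2 | (x != l) && (x != i0)].
have teamP l : l != i0 -> [/\ uniq (i0 :: team l), l \notin i0 :: team l &
    size (team l) = n].
  move=> li0; split.
  - by rewrite /= filter_uniq ?enum_uniq // mem_filter eqxx andbF.
  - by rewrite inE mem_filter eqxx orbF.
  - rewrite size_filter; have := cardsC [set l; i0].
    rewrite cards2 li0 card_ord cardE size_filter => /eq_add_S/eq_add_S sn.
    apply: etrans sn; rewrite enumT; apply: eq_count => x.
    by rewrite /= !inE negb_or.
have [ui ui' si] := teamP i ii0; have [u1 u1' s1] := teamP i1 i10.
pose p : {ffun 'I_n.+2 -> V} := [ffun x => if x == i then u else z].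
have pi : p i = u by rewrite ffunE eqxx.
have pi0 : p i0 = z by rewrite ffunE eq_sym (negbTE ii0).
apply: (@cops_win_wins _ _ _ _ p).
apply: (@wins_move _ _ _ _ _ p _ [set x | x != z]).
- exact: legal_move_refl.
- by move=> x y _ _ /freeP/(_ i0); rewrite pi0 inE eq_sym.
have kz : k <= dist e z u + (size (team i)).*2.+1 by rewrite si; lia.
apply: (@wins_guarded _ _ _ _ treeE i0 (team i) i u z true) => //.
- move=> c q S _ sc qi qc SB; apply: (wins_shadow treeE ui ui') qi qc SB.
  by move: kz (shadow_dist treeE sc); rewrite si; lia.
- move=> q _ qz.
  have -> : [set x | [&& x != z, ~~ shadow e u z x & true]] =
            [set x | (x != z) && ~~ shadow e u z x].
    by apply/setP => x; rewrite !inE andbT.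
  apply: (@wins_travel _ _ _ _ treeE i0 i1 v z (fun x => ~~ shadow e u z x))
    => // [x y nx xz yz xy|{}q {}qz qv].
    by rewrite -(shadow_step treeE u xz yz xy).
  have st : step e (q i0) z' by rewrite qz /step ezz' orbT.
  have q'z : move_to i0 z' q i0 = z' by rewrite ffunE eqxx.
  apply: (@wins_move _ _ _ _ _ (move_to i0 z' q) _ [set x | shadow e v z' x]).
  + exact: move_to_legal.
  + move=> x y; rewrite !inE => /andP[xz nx] /freeP/(_ i0) xz' /freeP/(_ i0) yz' xy.
    rewrite q'z eq_sym in xz'; rewrite q'z eq_sym in yz'.
    rewrite -(shadow_step treeE v xz' yz' xy).
    exact: (shadow_opposite treeE ezz' z'u zv).
  + apply: (wins_shadow treeE u1 u1' (s := v) (w := z')) => //.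
    * by rewrite s1; lia.
    * by rewrite move_to_other.
    * by move=> x; rewrite inE.
- by move=> x; rewrite inE => ->; rewrite orbT.
Qed.

Lemma diam_attained (V : finType) (e : rel V) :
  0 < #|V| -> exists u v, dist e u v = diam e.
Proof.
move=> V0; rewrite /diam.
have [u ->] := @bigop.eq_bigmax V (fun x => \max_y dist e x y) V0.
by have [v ->] := @bigop.eq_bigmax V (fun y => dist e u y) V0; exists u, v.
Qed.

(** * The bound *)

Local Open Scope ring_scope.

Lemma floor_sub_le (x y : rat) :
  Num.floor (x - y) <= Num.floor x - Num.floor y.
Proof.
rewrite -ltzD1 floor_lt_int.
have := floorD1_gt x; have := floor_le y; rewrite !intrD !intrN /=; lra.
Qed.

Theorem theorem4p9 (V : finType) (e : rel V) (k : nat) :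
  (0 < k)%N ->
  tree e ->
  (k + 1 <= diam e)%N ->
  (diam e)%:Z <= 2 * k%:Z - 4 ->
  (hyperopic_cop_number e k)%:Z
    <= 2 + Num.floor (k%:R / 2 - (diam e)%:R / 4 : rat)
  /\ 2 + Num.floor (k%:R / 2 - (diam e)%:R / 4 : rat)
    <= 2 + Num.floor (k%:R / 2 : rat) - Num.floor ((diam e)%:R / 4 : rat).
Proof.
move=> k0 treeE kd dk; split; last first.
  by rewrite -[leRHS]addrA lerD2l floor_sub_le.
have [_ [V0 _] _] := treeE; have [u [v uv]] := diam_attained e V0.
(* The upper half gives depth [k - j] on the side of [v], and at most as much
   on the side of [u] once the guard has moved one step. *)
pose j := uphalf (diam e); pose n := (k - j)./2.
have win : cops_win e k n.+2.
  by apply: (@tree_cops_win _ _ _ _ j u v); rewrite ?uv // /n /j; lia.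
have le : (hyperopic_cop_number e k <= n.+2)%N.
  rewrite /hyperopic_cop_number; case: ex_minnP => h _; apply.
  exact/boolp.asboolP.
have nf : n%:Z <= Num.floor (k%:R / 2 - (diam e)%:R / 4 : rat).
  rewrite floor_ge_int.
  have : (4 * n + diam e <= 2 * k)%N by rewrite /n /j; lia.
  rewrite -(ler_nat rat) natrD !natrM /=; lra.
lia.
Qed.
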